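(* Consider an LSTM with weight matrices $W_\square\in\mathbb{R}^{d\times d}$, $U_\square\in\mathbb{R}^{d\times n}$, $\square\in\{i,f,o,z\}$, whose inputs $x\in\mathbb{R}^n$ satisfy $\|x\|_\infty\le B_x$ for some finite $B_x$, with state-transition map $\phi_{\mathrm{LSTM}}$ and forget-gate bound $\|f\|_\infty<1$ as defined in the context. Suppose $$\|W_i\|_\infty<1-\|f\|_\infty,\quad \|W_o\|_\infty<1-\|f\|_\infty,\quad \|W_z\|_\infty\le\tfrac14(1-\|f\|_\infty),\quad \|W_f\|_\infty<(1-\|f\|_\infty)^2 .$$ Then for some $r=O(\log d)$ the iterated system $\phi_{\mathrm{LSTM}}^r$ is stable. Precisely: there is a constant $C$ depending only on $\|f\|_\infty,\|W_i\|_\infty,\|W_o\|_\infty,\|W_z\|_\infty,\|W_f\|_\infty$ (and not otherwise on $d$), an integer $r$ with $1\le r\le C(1+\log d)$, and some $\mu<1$, such that for all reachable states $s,s'\in\mathbb{R}^{2d}$ and all admissible inputs $x_1,\dots,x_r$, $$\big\|\phi^r_{\mathrm{LSTM}}(s;x_1,\dots,x_r)-\phi^r_{\mathrm{LSTM}}(s';x_1,\dots,x_r)\big\|_2\le\mu\,\|s-s'\|_2 .$$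
   Context: LSTM: the state is $s=(c,h)\in\mathbb{R}^{d}\times\mathbb{R}^d$. Given the previous state $(c_{t-1},h_{t-1})$ and input $x_t\in\mathbb{R}^n$, the next state $(c_t,h_t)=\phi_{\mathrm{LSTM}}((c_{t-1},h_{t-1}),x_t)$ is $$f_t=\sigma(W_fh_{t-1}+U_fx_t),\quad i_t=\sigma(W_ih_{t-1}+U_ix_t),\quad o_t=\sigma(W_oh_{t-1}+U_ox_t),\quad z_t=\tanh(W_zh_{t-1}+U_zx_t),$$ $$c_t=i_t\circ z_t+f_t\circ c_{t-1},\qquad h_t=o_t\circ\tanh(c_t),$$ where $\circ$ is elementwise multiplication, $\sigma(u)=1/(1+e^{-u})$, and $\sigma,\tanh$ act elementwise. The initial state is $s_0=0$. An input $x$ is admissible if $\|x\|_\infty\le B_x$. A state is reachable if it is obtained from $s_0=0$ by finitely many steps (possibly zero) with admissible inputs. $\|f\|_\infty=\sup_t\|f_t\|_\infty$, the supremum being over all times and all trajectories from $s_0=0$ with admissible inputs. For vectors $\|\cdot\|_\infty$ is the max norm; for matrices it is the induced norm $\|W\|_\infty=\max_i\sum_j|W_{ij}|$. The iterated system is the $r$-fold composition: $\phi^1_{\mathrm{LSTM}}(s;x_1)=\phi_{\mathrm{LSTM}}(s,x_1)$ and $\phi^{r}_{\mathrm{LSTM}}(s;x_1,\dots,x_r)=\phi_{\mathrm{LSTM}}(\phi^{r-1}_{\mathrm{LSTM}}(s;x_1,\dots,x_{r-1}),x_r)$. A system is stable if it is a contraction in the state, in the Euclidean norm, with factor less than 1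 uniformly over states and inputs. *)

(* Defs.v *)
From HB Require Import structures.
From mathcomp Require Import all_boot all_order all_algebra.
From mathcomp Require Import all_classical all_reals all_analysis.

Set Implicit Arguments.
Unset Strict Implicit.
Unset Printing Implicit Defensive.

Import Order.TTheory GRing.Theory Num.Theory.
Import numFieldNormedType.Exports.

Local Open Scope classical_set_scope.
Local Open Scope ring_scope.

Definition sigmoid (R : realType) (u : R) : R := (1 + expR (- u))^-1.

Definition tanh (R : realType) (u : R) : R :=
  (expR u - expR (- u)) / (expR u + expR (- u)).

(* The library norm `|W| of a matrix is the largest absolute value of an
   entry: the max norm on column vectors, but not the norm it induces on
   matrices, which is this one. *)
Definition mx_inf_norm (R : realType) (m n : nat) (W : 'M[R]_(m, n)) : R :=
  \big[Num.max/0]_(i < m) \sum_(j < n) `|W i j|.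

Definition enorm (R : realType) (m : nat) (v : 'cV[R]_m) : R :=
  Num.sqrt (\sum_(i < m) v i 0 ^+ 2).

Definition hadamard (R : realType) (m : nat) (u v : 'cV[R]_m) : 'cV[R]_m :=
  map2_mx *%R u v.

Record lstm (R : realType) (d n : nat) := Lstm {
  Wi : 'M[R]_d; Wf : 'M[R]_d; Wo : 'M[R]_d; Wz : 'M[R]_d;
  Ui : 'M[R]_(d, n); Uf : 'M[R]_(d, n); Uo : 'M[R]_(d, n); Uz : 'M[R]_(d, n)
}.

(* (c, h) *)
Definition state (R : realType) (d : nat) : Type := ('cV[R]_d * 'cV[R]_d)%type.

Section Lstm.
Variables (R : realType) (d n : nat) (L : lstm R d n).

Definition input_gate (h : 'cV[R]_d) (x : 'cV[R]_n) : 'cV[R]_d :=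
  map_mx (@sigmoid R) (Wi L *m h + Ui L *m x).

Definition forget_gate (h : 'cV[R]_d) (x : 'cV[R]_n) : 'cV[R]_d :=
  map_mx (@sigmoid R) (Wf L *m h + Uf L *m x).

Definition output_gate (h : 'cV[R]_d) (x : 'cV[R]_n) : 'cV[R]_d :=
  map_mx (@sigmoid R) (Wo L *m h + Uo L *m x).

Definition cell_input (h : 'cV[R]_d) (x : 'cV[R]_n) : 'cV[R]_d :=
  map_mx (@tanh R) (Wz L *m h + Uz L *m x).

Definition lstm_step (s : state R d) (x : 'cV[R]_n) : state R d :=
  let: (c, h) := s in
  let c' := hadamard (input_gate h x) (cell_input h x)
            + hadamard (forget_gate h x) c in
  (c', hadamard (output_gate h x) (map_mx (@tanh R) c')).

(* The inputs are consumed from left to right. *)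
Definition lstm_iter (s : state R d) (xs : seq 'cV[R]_n) : state R d :=
  foldl lstm_step s xs.

Definition admissible (Bx : R) (x : 'cV[R]_n) : Prop := `|x| <= Bx.

Definition reachable (Bx : R) (s : state R d) : Prop :=
  exists2 xs : seq 'cV[R]_n,
    (forall x, x \in xs -> admissible Bx x) & s = lstm_iter (0, 0) xs.

(* A vector is the value f_t of the forget gate along some trajectory from 0
   exactly when it is computed from a reachable state s_(t-1) and an
   admissible input x_t. The set below is bounded by 1, since sigmoid is, and
   is nonempty as soon as 0 <= Bx, so that sup is then a genuine supremum. *)
Definition forget_norm (Bx : R) : R :=
  sup [set a : R | exists s x,
    [/\ reachable Bx s, admissible Bx x & a = `|forget_gate s.2 x|]].

End Lstm.

(* The pair is read as the stacked vector of R^(2d); the library norm of a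
   pair is the max norm. *)
Definition state_enorm (R : realType) (d : nat) (s : state R d) : R :=
  enorm (col_mx s.1 s.2).

Definition state_sub (R : realType) (d : nat) (s s' : state R d) : state R d :=
  (s.1 - s'.1, s.2 - s'.2).

(* Main.v *)
(* One step of the LSTM already contracts reachable states in the max norm, with
   a factor k < 1 computed from the norms alone: writing F for the forget bound,
   the cell satisfies |c| <= 1 / (1 - F), the gate i, the input z and the gate f
   each perturb c by at most (1 - F)/4 times the perturbation of h, and the
   gate o perturbs h by less than (1 - F)/4 more. Passing between the max norm
   and the Euclidean norm on R^(2d) costs a factor sqrt(2d), which k^r
   absorbs as soon as r > (1 + ln d) / (1 - k). *)
Require Import Defs.
From HB Require Import structures.
From mathcomp Require Import all_boot all_order all_algebra.
From mathcomp Require Import all_classical all_reals all_analysis.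
From mathcomp Require Import ring lra.

Set Implicit Arguments.
Unset Strict Implicit.
Unset Printing Implicit Defensive.

Import Order.TTheory GRing.Theory Num.Theory.
Import numFieldNormedType.Exports.

Local Open Scope ring_scope.

(** * Bounds and Lipschitz constants of the activation functions *)

Lemma lipschitz_of_derive (R : realType) (f df : R -> R) (k : R) :
  (forall x : R, is_derive x 1 f (df x)) -> (forall x, `|df x| <= k) ->
  forall a b, `|f a - f b| <= k * `|a - b|.
Proof.
move=> fdf dfk a b.
wlog ab : a b / a <= b => [H|].
  have [/H//|/ltW/H] := leP a b.
  by rewrite distrC (distrC b).
rewrite distrC (distrC a).
have [|c _ ->] := @MVT_segment R f df a b ab (fun x _ => fdf x).
  apply: continuous_subspaceT => x; apply: differentiable_continuous.
  by apply/derivable1_diffP; case: (fdf x).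
by rewrite normrM ler_wpM2r.
Qed.

Lemma sigmoid_gt0 (R : realType) (u : R) : 0 < sigmoid u.
Proof. by rewrite /sigmoid invr_gt0 addr_gt0 // expR_gt0. Qed.

Lemma sigmoid_lt1 (R : realType) (u : R) : sigmoid u < 1.
Proof. by rewrite /sigmoid invf_lt1 ?ltrDl ?addr_gt0 ?expR_gt0. Qed.

Lemma normr_sigmoid_le1 (R : realType) (u : R) : `|sigmoid u| <= 1.
Proof. by rewrite ger0_norm ?ltW ?sigmoid_lt1 ?sigmoid_gt0. Qed.

Lemma is_derive_sigmoid (R : realType) (u : R) :
  is_derive u 1 (@sigmoid R) (sigmoid u * (1 - sigmoid u)).
Proof.
have e0 : 1 + expR (- u) != 0 by rewrite gt_eqF // addr_gt0 // expR_gt0.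
have d1 : is_derive u 1 (fun v : R => 1 + expR (- v)) (- expR (- u)).
  by apply: is_derive_eq; ring.
suff -> : sigmoid u * (1 - sigmoid u)
          = - (1 + expR (- u)) ^- 2 *: (- expR (- u) : R^o).
  exact: (@is_deriveV _ (fun v : R => 1 + expR (- v))).
by rewrite /sigmoid /GRing.scale /=; field.
Qed.

(** The derivative is [p * (1 - p)] with [p = sigmoid u], and this is at most 1/4 because
    [(p - 1/2) ^ 2] is nonnegative. *)
Lemma sigmoid_lipschitz (R : realType) (a b : R) :
  `|sigmoid a - sigmoid b| <= 4%:R^-1 * `|a - b|.
Proof.
apply: lipschitz_of_derive => [u|u]; first exact: is_derive_sigmoid.
have := sigmoid_gt0 u; have := sigmoid_lt1 u.
move: (sigmoid u) => p p1 p0; have := sqr_ge0 (p - 2^-1).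
by rewrite ger0_norm; nra.
Qed.

(** Carries the facts about [sigmoid] over to [tanh], which is then never differentiated: the
    Lipschitz constant becomes 2 * 1/4 * 2 = 1. *)
Lemma tanh_sigmoid (R : realType) (u : R) : tanh u = 2 * sigmoid (2 * u) - 1.
Proof.
rewrite /tanh /sigmoid -mulrN expRM_natl expRN.
have e0 := expR_gt0 u; field.
by do ?[apply/andP; split]; rewrite gt_eqF //; nra.
Qed.

Lemma tanh_lipschitz (R : realType) (a b : R) : `|tanh a - tanh b| <= `|a - b|.
Proof.
rewrite !tanh_sigmoid.
have -> : 2 * sigmoid (2 * a) - 1 - (2 * sigmoid (2 * b) - 1)
          = 2 * (sigmoid (2 * a) - sigmoid (2 * b)) by ring.
rewrite normrM ger0_norm //.
have := sigmoid_lipschitz (2 * a) (2 * b).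
rewrite -mulrBr [X in _ <= _ * X]normrM (ger0_norm (x := 2)) //; lra.
Qed.

Lemma normr_tanh_le1 (R : realType) (u : R) : `|tanh u| <= 1.
Proof.
rewrite tanh_sigmoid ler_norml.
have := sigmoid_gt0 (2 * u); have := sigmoid_lt1 (2 * u); lra.
Qed.

Lemma distrM_le (R : realType) (a b a' b' : R) :
  `|a * b - a' * b'| <= `|a - a'| * `|b| + `|a'| * `|b - b'|.
Proof.
have -> : a * b - a' * b' = (a - a') * b + a' * (b - b') by ring.
by rewrite -!normrM; exact: ler_normD.
Qed.

(** * Matrix and vector norms, read entry by entry *)

Lemma mx_inf_norm_ge0 (R : realType) (m n : nat) (W : 'M[R]_(m, n)) :
  0 <= mx_inf_norm W.
Proof. exact: bigmax_ge_id. Qed.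

Lemma mulmx_inf_norm_le (R : realType) (m n : nat) (W : 'M[R]_(m, n))
    (v : 'cV[R]_n) (D : R) :
  (forall j, `|v j 0| <= D) -> forall i, `|(W *m v) i 0| <= mx_inf_norm W * D.
Proof.
move=> vD i; rewrite mxE.
apply: (@le_trans _ _ (\sum_j `|W i j| * D)).
  apply: le_trans (ler_norm_sum _ _ _) (ler_sum _ _) => j _.
  by rewrite normrM ler_wpM2l.
rewrite -mulr_suml.
(* An index [j] forces [0 <= D], as monotonicity of the product needs; when [n] is 0 the row sums
   are empty and both sides vanish. *)
have [j _|n0] := pickP 'I_n.
  apply: ler_wpM2r; first exact: le_trans (vD j).
  exact: (le_bigmax _ (fun i => \sum_j `|W i j|)).
have D0 : \sum_j `|W i j| = 0 by rewrite big_pred0.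
have -> : mx_inf_norm W = 0.
  apply/eqP; rewrite eq_le mx_inf_norm_ge0 andbT.
  by apply/bigmax_leP; split=> // k _; rewrite big_pred0.
by rewrite D0 !mul0r.
Qed.

(** Both runs read the same input [x], so [U *m x] cancels in the difference of the
    preactivations. *)
Lemma gate_lipschitz (R : realType) (g : R -> R) (k : R) (m n p : nat)
    (W : 'M[R]_(m, n)) (U : 'M[R]_(m, p)) (h h' : 'cV[R]_n) (x : 'cV[R]_p)
    (D : R) :
  0 <= k -> (forall a b, `|g a - g b| <= k * `|a - b|) ->
  (forall j, `|h j 0 - h' j 0| <= D) ->
  forall i, `|map_mx g (W *m h + U *m x) i 0 - map_mx g (W *m h' + U *m x) i 0|
            <= k * (mx_inf_norm W * D).
Proof.
move=> k0 gk hD i; rewrite [X in `|X - _|]mxE [X in `|_ - X|]mxE.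
apply: le_trans (gk _ _) (ler_wpM2l k0 _).
have -> : (W *m h + U *m x) i 0 - (W *m h' + U *m x) i 0 = (W *m (h - h')) i 0.
  by rewrite mulmxBr [LHS]addrC !mxE; ring.
by apply: mulmx_inf_norm_le => j; rewrite !mxE.
Qed.

Lemma le_mx_norm_entry (R : realType) (m n : nat) (A : 'M[R]_(m, n)) i j :
  `|A i j| <= `|A|.
Proof. by rewrite [leRHS]mx_normrE; exact: (le_bigmax _ _ (i, j)). Qed.

Lemma mx_norm_le (R : realType) (m n : nat) (A : 'M[R]_(m, n)) (D : R) :
  0 <= D -> (forall i j, `|A i j| <= D) -> `|A| <= D.
Proof.
by move=> D0 AD; rewrite [leLHS]mx_normrE; apply/bigmax_leP; split=> // -[i j].
Qed.

Lemma le_normr_enorm (R : realType) (m : nat) (v : 'cV[R]_m) i :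
  `|v i 0| <= enorm v.
Proof.
rewrite /enorm -sqrtr_sqr ler_wsqrtr // (bigD1 i) //= lerDl.
by apply: sumr_ge0 => j _; exact: sqr_ge0.
Qed.

Lemma enorm_le (R : realType) (m : nat) (v : 'cV[R]_m) (D : R) :
  0 <= D -> (forall i, `|v i 0| <= D) -> enorm v <= Num.sqrt m%:R * D.
Proof.
move=> D0 vD; rewrite /enorm -[X in _ * X](ger0_norm D0) -sqrtr_sqr -sqrtrM //.
apply: ler_wsqrtr.
have -> : m%:R * D ^+ 2 = \sum_(i < m) D ^+ 2.
  by rewrite sumr_const card_ord mulr_natl.
apply: ler_sum => i _.
by rewrite -[v i 0 ^+ 2]real_normK ?num_real // lerXn2r ?nnegrE.
Qed.

(** * Bounds along reachable trajectories *)

Lemma reachable_step (R : realType) (d n : nat) (L : lstm R d n) (Bx : R) s x :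
  reachable L Bx s -> admissible Bx x -> reachable L Bx (lstm_step L s x).
Proof.
move=> [xs xsB ->] xB; exists (rcons xs x).
  by move=> y; rewrite mem_rcons inE => /predU1P[->|/xsB].
by rewrite /lstm_iter foldl_rcons.
Qed.

Lemma forget_gate_norm_le (R : realType) (d n : nat) (L : lstm R d n) (Bx : R)
    s x :
  reachable L Bx s -> admissible Bx x ->
  `|forget_gate L s.2 x| <= forget_norm L Bx.
Proof.
move=> sR xB; apply: ub_le_sup; last by exists s, x.
(* The supremum dominates its elements only for a set bounded above; 1 is a bound because the gate
   is a sigmoid. *)
exists 1 => _ [s' [x' [_ _ ->]]].
by apply: mx_norm_le => // j k; rewrite mxE normr_sigmoid_le1.
Qed.

Lemma forget_gate_le (R : realType) (d n : nat) (L : lstm R d n) (Bx : R) s x :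
  reachable L Bx s -> admissible Bx x ->
  forall i, `|forget_gate L s.2 x i 0| <= forget_norm L Bx.
Proof.
move=> sR xB i; apply: le_trans (le_mx_norm_entry _ _ _) _.
exact: forget_gate_norm_le.
Qed.

Lemma forget_norm_ge0 (R : realType) (d n : nat) (L : lstm R d n) (Bx : R) :
  0 <= forget_norm L Bx.
Proof.
have [E0|/set0P[_ [s [x [sR xB _]]]]] := eqVneq [set a : R | exists s x,
    [/\ reachable L Bx s, admissible Bx x & a = `|forget_gate L s.2 x|]]%classic
    set0%classic.
  (* With no admissible input the set is empty and its [sup] is 0 by convention. *)
  by rewrite /forget_norm E0 sup0.
exact: le_trans (normr_ge0 _) (forget_gate_norm_le sR xB).
Qed.

Lemma lstm_step_cell (R : realType) (d n : nat) (L : lstm R d n) s x i :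
  (lstm_step L s x).1 i 0 =
  input_gate L s.2 x i 0 * cell_input L s.2 x i 0
  + s.1 i 0 * forget_gate L s.2 x i 0.
Proof. by case: s => c h; rewrite /= !mxE; congr (_ + _); exact: mulrC. Qed.

Lemma lstm_step_hidden (R : realType) (d n : nat) (L : lstm R d n) s x i :
  (lstm_step L s x).2 i 0 =
  output_gate L s.2 x i 0 * tanh ((lstm_step L s x).1 i 0).
Proof. by case: s => c h; rewrite /= !mxE. Qed.

(** One step turns a bound [b] on the cell into [1 + F * b], where [F] is the forget bound, and
    [1 / (1 - F)] is the fixed point of this map. *)
Lemma reachable_cell_le (R : realType) (d n : nat) (L : lstm R d n) (Bx : R) s :
  forget_norm L Bx < 1 -> reachable L Bx s ->
  forall i, `|s.1 i 0| <= (1 - forget_norm L Bx)^-1.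
Proof.
move=> F1 [xs + ->]; have F1' : 0 < 1 - forget_norm L Bx by rewrite subr_gt0.
(* Induction on the last input, since the state before it is again reachable from 0. *)
elim/last_ind: xs => [|xs x IH] xsB i; first by rewrite mxE normr0 invr_ge0 ltW.
have xsB' y : y \in xs -> admissible Bx y.
  by move=> yxs; apply: xsB; rewrite mem_rcons inE yxs orbT.
have xB : admissible Bx x by apply: xsB; rewrite mem_rcons mem_head.
have sR : reachable L Bx (lstm_iter L (0, 0) xs) by exists xs.
rewrite /lstm_iter foldl_rcons -/(lstm_iter L (0, 0) xs) lstm_step_cell.
apply: le_trans (ler_normD _ _) _; rewrite !normrM.
have -> : (1 - forget_norm L Bx)^-1
    = 1 * 1 + (1 - forget_norm L Bx)^-1 * forget_norm L Bx.
  by field; rewrite gt_eqF.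
apply: lerD; apply: ler_pM; try exact: normr_ge0.
- by rewrite mxE normr_sigmoid_le1.
- by rewrite mxE normr_tanh_le1.
- exact: IH.
- exact: (forget_gate_le sR xB).
Qed.

(** * Contraction in the max norm *)

(* [F] is the feedback of the cell, and the other terms come from the gates i,
   z, f and o: [|sigmoid'| <= 1/4], [|tanh'| <= 1], [|c| <= (1 - F)^-1]. *)
Definition lstm_rate (R : realType) (F wi wo wz wf : R) : R :=
  F + (wi / 4 + wz + wf / 4 / (1 - F)) + wo / 4.

(** Each of the four weight terms is at most [(1 - F) / 4], so together with [F] they stay below 1.
    The bound on [wf] is quadratic because its term is divided by [1 - F]. *)
Lemma lstm_rate_lt1 (R : realType) (F wi wo wz wf : R) :
  F < 1 -> wi < 1 - F -> wo < 1 - F -> wz <= 4%:R^-1 * (1 - F) ->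
  wf < (1 - F) ^+ 2 -> lstm_rate F wi wo wz wf < 1.
Proof.
move=> F1 hi ho hz hf.
have hf' : wf / 4 / (1 - F) < (1 - F) / 4.
  by rewrite ltr_pdivrMr ?subr_gt0 //; move: hf; rewrite expr2; lra.
rewrite /lstm_rate; lra.
Qed.

Lemma lstm_step_contraction (R : realType) (d n : nat) (L : lstm R d n)
    (Bx : R) (s s' : state R d) (x : 'cV[R]_n) (D : R) :
  forget_norm L Bx < 1 ->
  reachable L Bx s -> reachable L Bx s' -> admissible Bx x ->
  (forall i, `|s.1 i 0 - s'.1 i 0| <= D) ->
  (forall i, `|s.2 i 0 - s'.2 i 0| <= D) ->
  let k := lstm_rate (forget_norm L Bx) (mx_inf_norm (Wi L))
             (mx_inf_norm (Wo L)) (mx_inf_norm (Wz L)) (mx_inf_norm (Wf L)) in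
  (forall i, `|(lstm_step L s x).1 i 0 - (lstm_step L s' x).1 i 0| <= k * D) /\
  (forall i, `|(lstm_step L s x).2 i 0 - (lstm_step L s' x).2 i 0| <= k * D).
Proof.
move=> F1 sR s'R xB cD hD k.
have F1' : 0 < 1 - forget_norm L Bx by rewrite subr_gt0.
have wi0 := mx_inf_norm_ge0 (Wi L); have wo0 := mx_inf_norm_ge0 (Wo L).
(* The rate of the cell alone; the output gate later adds [wo / 4] for the hidden part, which gives
   [k]. *)
pose kc := forget_norm L Bx + (mx_inf_norm (Wi L) / 4 + mx_inf_norm (Wz L)
           + mx_inf_norm (Wf L) / 4 / (1 - forget_norm L Bx)).
have sig := @sigmoid_lipschitz R.
have tan a b : `|tanh a - tanh b| <= 1 * `|a - b| :> R.
  by rewrite mul1r; exact: tanh_lipschitz.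
have q0 : 0 <= 4%:R^-1 :> R by rewrite invr_ge0.
have cell i : `|(lstm_step L s x).1 i 0 - (lstm_step L s' x).1 i 0| <= kc * D.
  rewrite !lstm_step_cell opprD addrACA.
  apply: le_trans (ler_normD _ _) _.
  (* Split to match [distrM_le] applied to the products i * z and c * f. *)
  have -> : kc * D =
      (4%:R^-1 * (mx_inf_norm (Wi L) * D) * 1 + 1 * (1 * (mx_inf_norm (Wz L) * D)))
      + (D * forget_norm L Bx + (1 - forget_norm L Bx)^-1
                             * (4%:R^-1 * (mx_inf_norm (Wf L) * D))).
    by rewrite /kc; field; rewrite gt_eqF.
  apply: lerD; (apply: le_trans (distrM_le _ _ _ _) _); apply: lerD;
    apply: ler_pM; try exact: normr_ge0.
  - exact: gate_lipschitz.
  - by rewrite mxE normr_tanh_le1.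
  - by rewrite mxE normr_sigmoid_le1.
  - exact: gate_lipschitz.
  - exact: cD.
  - exact: (forget_gate_le sR xB).
  - exact: (reachable_cell_le F1 s'R).
  - exact: gate_lipschitz.
split=> i.
  apply: le_trans (cell i) _.
  (* The hypothesis at the index [i] yields [0 <= D]. *)
  rewrite ler_wpM2r ?(le_trans _ (cD i)) //.
  by rewrite /k /lstm_rate -/kc lerDl mulr_ge0.
rewrite !lstm_step_hidden.
apply: le_trans (distrM_le _ _ _ _) _.
(* The new hidden part sees the new cell through the 1-Lipschitz [tanh], hence the factor [kc]. *)
have -> : k * D = 4%:R^-1 * (mx_inf_norm (Wo L) * D) * 1 + 1 * (kc * D).
  by rewrite /k /lstm_rate -/kc; field.
apply: lerD; apply: ler_pM; try exact: normr_ge0.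
- exact: gate_lipschitz.
- exact: normr_tanh_le1.
- by rewrite mxE normr_sigmoid_le1.
- exact: le_trans (tanh_lipschitz _ _) (cell i).
Qed.

Lemma lstm_iter_contraction (R : realType) (d n : nat) (L : lstm R d n)
    (Bx : R) (xs : seq 'cV[R]_n) (s s' : state R d) (D : R) :
  forget_norm L Bx < 1 ->
  reachable L Bx s -> reachable L Bx s' ->
  (forall x, x \in xs -> admissible Bx x) ->
  (forall i, `|s.1 i 0 - s'.1 i 0| <= D) ->
  (forall i, `|s.2 i 0 - s'.2 i 0| <= D) ->
  let k := lstm_rate (forget_norm L Bx) (mx_inf_norm (Wi L))
             (mx_inf_norm (Wo L)) (mx_inf_norm (Wz L)) (mx_inf_norm (Wf L)) in
  (forall i, `|(lstm_iter L s xs).1 i 0 - (lstm_iter L s' xs).1 i 0|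
             <= k ^+ size xs * D) /\
  (forall i, `|(lstm_iter L s xs).2 i 0 - (lstm_iter L s' xs).2 i 0|
             <= k ^+ size xs * D).
Proof.
move=> F1 + + + + + k.
elim: xs s s' D => [|x xs IH] s s' D sR s'R xsB cD hD; first by rewrite mul1r.
have xB : admissible Bx x by apply: xsB; exact: mem_head.
have [cD' hD'] := lstm_step_contraction F1 sR s'R xB cD hD.
(* The first input is consumed first, so the induction hypothesis is used from the next states with
   [k * D] in place of [D]. *)
rewrite exprSr -mulrA.
apply: IH cD' hD' => [| |y yxs]; [exact: reachable_step.. |].
by apply: xsB; rewrite inE yxs orbT.
Qed.

(** * Number of iterations and return to the Euclidean norm *)

(** From [k <= exp (- (1 - k))] one gets [k ^ r <= exp (- r (1 - k))], and the lower bound on [r]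
    makes this small enough to absorb the square root of [2d]. *)
Lemma expr_lt_invsqrt (R : realType) (k : R) (d r : nat) :
  (0 < d)%N -> 0 <= k -> k < 1 -> (1 + ln d%:R) / (1 - k) < r%:R ->
  Num.sqrt (d + d)%:R * k ^+ r < 1.
Proof.
move=> d0 k0 k1 hr; have dpos : 0 < d%:R :> R by rewrite ltr0n.
have kr : k ^+ r <= expR (- (r%:R * (1 - k))).
  rewrite -mulrN expRM_natl lerXn2r ?nnegrE ?expR_ge0 //.
  by have := expR_ge1Dx (- (1 - k)); lra.
apply: (@le_lt_trans _ _ (Num.sqrt (d + d)%:R * expR (- (r%:R * (1 - k))))).
  by rewrite ler_wpM2l ?sqrtr_ge0.
rewrite expRN ltr_pdivrMr ?expR_gt0 // mul1r.
rewrite -[ltRHS]ger0_norm ?expR_ge0 // -sqrtr_sqr ltr_sqrt ?exprn_gt0 ?expR_gt0 //.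
rewrite ltr_pdivrMr ?subr_gt0 // in hr.
(* After squaring, the claim is [2d < exp (2 r (1 - k))]. The intermediate value is [e * d], at
   least [2d] since [e >= 1 + 1]. *)
apply: (@le_lt_trans _ _ (expR (1 + ln d%:R))).
  rewrite expRD lnK ?posrE // natrD.
  have e1 := expR_ge1Dx (1 : R).
  nra.
rewrite -expRM_natl ltr_expR.
have : 0 <= ln d%:R :> R by rewrite ln_ge0 // ler1n.
lra.
Qed.

Theorem proposition2 (R : realType) :
  exists C : R -> R -> R -> R -> R -> R,
  forall (d n : nat) (L : lstm R d n) (Bx : R),
    (0 < d)%N ->
    forget_norm L Bx < 1 ->
    mx_inf_norm (Wi L) < 1 - forget_norm L Bx ->
    mx_inf_norm (Wo L) < 1 - forget_norm L Bx ->
    mx_inf_norm (Wz L) <= 4%:R^-1 * (1 - forget_norm L Bx) ->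
    mx_inf_norm (Wf L) < (1 - forget_norm L Bx) ^+ 2 ->
    exists (r : nat) (mu : R),
      [/\ (1 <= r)%N,
          r%:R <= C (forget_norm L Bx) (mx_inf_norm (Wi L))
                    (mx_inf_norm (Wo L)) (mx_inf_norm (Wz L))
                    (mx_inf_norm (Wf L)) * (1 + ln d%:R),
          mu < 1 &
          forall (s s' : state R d) (xs : r.-tuple 'cV[R]_n),
            reachable L Bx s -> reachable L Bx s' ->
            (forall i : 'I_r, admissible Bx (tnth xs i)) ->
            state_enorm (state_sub (lstm_iter L s xs) (lstm_iter L s' xs))
              <= mu * state_enorm (state_sub s s')].
Proof.
(* The added 1 pays for rounding [(1 + ln d) / (1 - k)] up to an integer, because
   [1 + ln d >= 1]. *)
exists (fun F wi wo wz wf => (1 - lstm_rate F wi wo wz wf)^-1 + 1).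
move=> d n L Bx d0 F1 hi ho hz hf.
set k := lstm_rate _ _ _ _ _.
have k1 : k < 1 by exact: lstm_rate_lt1.
have F0 : 0 <= 1 - forget_norm L Bx by rewrite subr_ge0 ltW.
have k0 : 0 <= k.
  by rewrite /k /lstm_rate !(F0, forget_norm_ge0, mx_inf_norm_ge0, addr_ge0,
    divr_ge0).
have ln0 : 0 <= ln d%:R :> R by rewrite ln_ge0 // ler1n.
pose t : R := (1 + ln d%:R) / (1 - k).
have t0 : 0 <= t by apply: divr_ge0; [exact: addr_ge0 | rewrite subr_ge0 ltW].
(* The successor makes [r] positive and strictly larger than [t], while [r <= t + 1] as [t] is
   nonnegative. *)
pose r := (Num.truncn t).+1.
exists r, (Num.sqrt (d + d)%:R * k ^+ r); split=> //.
- have : (Num.truncn t)%:R <= t by rewrite truncn_le.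
  rewrite /r -natr1 mulrDl mul1r [_^-1 * _]mulrC -/t; lra.
- by apply: expr_lt_invsqrt => //; exact: truncnS_gt.
move=> s s' xs sR s'R xsB.
(* The Euclidean norm bounds every coordinate, so it can serve as the initial max-norm bound at no
   cost; the factor [sqrt (2d)] is paid only on the way back, by [enorm_le]. *)
pose D := state_enorm (state_sub s s').
have cD i : `|s.1 i 0 - s'.1 i 0| <= D.
  have := le_normr_enorm (col_mx (s.1 - s'.1) (s.2 - s'.2)) (lshift d i).
  by rewrite col_mxEu !mxE.
have hD i : `|s.2 i 0 - s'.2 i 0| <= D.
  have := le_normr_enorm (col_mx (s.1 - s'.1) (s.2 - s'.2)) (rshift d i).
  by rewrite col_mxEd !mxE.
have xsB' x : x \in tval xs -> admissible Bx x.
  by move=> /tnthP[i ->]; exact: xsB.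
have [cr hr] := lstm_iter_contraction F1 sR s'R xsB' cD hD.
rewrite -mulrA; apply: enorm_le => [|i].
  by rewrite mulr_ge0 ?exprn_ge0 // sqrtr_ge0.
rewrite size_tuple in cr hr.
by rewrite -(splitK i); case: (fintype.split i) => j /=;
  rewrite ?col_mxEu ?col_mxEd !mxE.
Qed.
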